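(* Let $c<d$ and $a \le 0 \le b$ be real constants, let $\alpha>0$ and let $m\in(0,1]$. Let $g$, $G$ and the associated kernel $T$ on the interval $[c,d]$ be as described in the context. If $f: [c,d] \rightarrow [a,b]$ is a measurable function, $\varphi:[a,b]\to\mathbb{R}$ is a continuous $m$-convex function on $[a,b]$, and $$ \mathbb{T}(\alpha) = \int _{ c }^{ d } \frac { 1 }{ T(d,s,\alpha ) } \, ds = \int _{ 0 }^{ g(d)-g(c) } \frac { dx}{ G(x,\alpha ) } < \infty , $$ then the functions $s\mapsto f(s)/T(d,s,\alpha)$ and $s\mapsto \varphi(mf(s))/T(d,s,\alpha)$ belong to $L^1[c,d]$ and $$ \varphi \Big( ma+m^2b - \frac { m^2 }{\mathbb{T}(\alpha )}\int_{c}^d \frac { f(s) }{ T(d,s,\alpha) } \, ds \Big) \le m\varphi(a) + m^2\varphi(b) - \frac { m }{\mathbb{T}(\alpha )}\int_{c}^d \frac { \varphi(mf(s)) }{ T(d,s,\alpha) } \, ds . $$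
   Context: Let $I\subseteq \mathbb{R}$ be an interval containing $0$ and let $m\in (0,1]$. A function $\varphi:I \rightarrow \mathbb{R}$ is called $m$-convex if $$\varphi(t x+m(1-t) y) \leq t \varphi(x)+m(1-t) \varphi(y)$$ for all $x,y\in I$ and all $t\in [0,1]$. Here $g:[c,d] \rightarrow \mathbb{R}$ is a function that is positive on $(c,d]$ and has a continuous positive derivative on $(c,d)$, and $G:[0, g(d)-g(c)]\times (0,\infty)\rightarrow \mathbb{R}$ is a continuous function which is positive on $(0, g(d)-g(c)]\times (0,\infty)$. The kernel $T:[c,d]\times[c,d]\times(0,\infty)\to\mathbb{R}$ is defined by $$ T(t,s,\alpha) = \frac{ G\big( |g(t)-g(s)| ,\alpha \big) }{ g'(s) } . $$ (The integral $\int_c^t f(s)/T(t,s,\alpha)\,ds$ is the generalized Riemann-Liouville-type integral of $f$ of order $\alpha$ at $t$.) *)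

(* Defs.v *)
(* MathComp-Analysis, over an abstract realType. *)
From HB Require Import structures.
From mathcomp Require Import all_boot all_order all_algebra.
From mathcomp Require Import all_classical all_reals all_analysis.

Set Implicit Arguments.
Unset Strict Implicit.
Unset Printing Implicit Defensive.

Import Order.TTheory GRing.Theory Num.Theory.
Import numFieldNormedType.Exports.

Local Open Scope classical_set_scope.
Local Open Scope ring_scope.

(* The real line with the sigma-algebra of Lebesgue (not only Borel) measurable
   sets; this is the domain of [completed_lebesgue_measure]. *)
Notation lebesgueR R :=
  (caratheodory_type (mu_ext (wlength (idfun : R -> R)))) (only parsing).

Definition leb (R : realType) :
    {measure set (lebesgueR R) -> \bar R} :=
  @completed_lebesgue_measure R.

(* The standing assumptions on [I] (an interval containing 0) and on [m]
   (0 < m <= 1) are left to the statements using this predicate; they guarantee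
   that the point t x + m (1 - t) y lies in [I]. *)
Definition m_convex (R : realType) (I : set R) (m : R) (phi : R -> R) : Prop :=
  forall x y t : R, I x -> I y -> 0 <= t <= 1 ->
    phi (t * x + m * (1 - t) * y) <= t * phi x + m * (1 - t) * phi y.

(* [g] and [G] are total functions standing for functions on [c, d] and on
   [0, g d - g c] x ]0, +oo[.  [derive1 g] is meaningful on ]c, d[ only: for s = c
   or s = d the value of the kernel is arbitrary, which does not affect
   integrals in s. *)
Definition rl_kernel (R : realType) (g : R -> R) (G : R -> R -> R)
    (t s alpha : R) : R :=
  G `|g t - g s| alpha / derive1 g s.

Definition kernel_base (R : realType) (c d : R) (g : R -> R) : Prop :=
  [/\ forall s, s \in `]c, d] -> 0 < g s,
      forall s, s \in `]c, d[ -> derivable g s 1,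
      {in `]c, d[, continuous (derive1 g)} &
      forall s, s \in `]c, d[ -> 0 < derive1 g s].

(* The first conjunct expresses that the kernel is well defined on
   [c, d] x [c, d], i.e. that [G] is evaluated inside its domain
   [0, g d - g c] x ]0, +oo[. *)
Definition kernel_profile (R : realType) (c d : R) (g : R -> R)
    (G : R -> R -> R) : Prop :=
  [/\ forall t s, t \in `[c, d] -> s \in `[c, d] ->
        `|g t - g s| \in `[0, g d - g c],
      {within `[0, g d - g c] `*` `]0, +oo[,
         continuous (fun p : R * R => G p.1 p.2)} &
      forall x alpha, x \in `]0, g d - g c] -> 0 < alpha -> 0 < G x alpha].

(* Main.v *)
(* Writing x = t a + (1 - t) b for x in [a, b], two applications of m-convexity
   give phi (m x) <= m t (phi a) + m (1 - t) (phi b), and the weights m t and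
   1 - m t give
     phi (m a + m^2 b - m^2 x) <= m (1 - m t) (phi a) + m^2 t (phi b).
   As t is an affine function of x, the first inequality at x = f s can be
   averaged against the positive weight 1 / T(d, s, alpha); the second one is
   used at the weighted mean of f, which lies in [a, b]. *)
Require Import Defs.
From HB Require Import structures.
From mathcomp Require Import all_boot all_order all_algebra.
From mathcomp Require Import all_classical all_reals all_analysis.
From mathcomp Require Import measurable_realfun.
From mathcomp Require Import ring lra.
Import Order.TTheory GRing.Theory Num.Theory.
Import numFieldNormedType.Exports.
Local Open Scope classical_set_scope.
Local Open Scope ring_scope.

Set Implicit Arguments.
Unset Strict Implicit.

(** * Pointwise inequalities from m-convexity *)

Lemma barycentric_itvcc (R : realFieldType) (a b x : R) (t := (b - x) / (b - a)) :
  x \in `[a, b] -> 0 <= t <= 1 /\ x = t * a + (1 - t) * b.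
Proof.
rewrite in_itv /= => /andP[ax xb].
have [ab|ab] := eqVneq a b. (* then t = 0, as division by 0 gives 0 *)
  have -> : t = 0 by rewrite /t ab subrr invr0 mulr0.
  by rewrite lexx ler01; split=> //; lra.
have ab0 : 0 < b - a by rewrite subr_gt0 lt_neqAle ab (le_trans ax xb).
split; last by rewrite /t; field; rewrite gt_eqF.
by rewrite divr_ge0 ?ler_pdivrMr //; lra.
Qed.

(** Since m x = t (m a) + m (1 - t) b, m-convexity is applied to [m * a] and [b], where a <= 0 <= b
    puts [m * a] in [a, b]; at weight 0 it also gives phi (m a) <= m phi a. The bound is written as
    an affine function of x so that it can be integrated. *)
Lemma m_convex_le_chord (R : realType) (a b m : R) (phi : R -> R) (x : R) :
  a <= 0 -> 0 <= b -> 0 <= m <= 1 -> m_convex `[a, b] m phi -> x \in `[a, b] ->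
  phi (m * x) <= m * phi b + m * ((b - x) / (b - a)) * (phi a - phi b).
Proof.
move=> a0 b0 /andP[m0 m1] hphi /barycentric_itvcc[].
set t := _ / _ => t01 ->.
have Ia : `[a, b]%classic a by rewrite /= in_itv /= lexx (le_trans a0 b0).
have Ib : `[a, b]%classic b by rewrite /= in_itv /= lexx (le_trans a0 b0).
have Ima : `[a, b]%classic (m * a) by rewrite /= in_itv /=; apply/andP; split; nra.
have h1 : phi (m * a) <= m * phi a.
  have := hphi a a 0 Ia Ia; rewrite lexx ler01 => /(_ isT).
  by rewrite !mul0r !add0r subr0 mulr1.
have := hphi (m * a) b t Ima Ib t01.
rewrite (_ : t * (m * a) + m * (1 - t) * b = m * (t * a + (1 - t) * b)); last by ring.
move: t01 => /andP[t0 t1] h2; have := ler_wpM2l t0 h1; lra.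
Qed.

(** The right-hand side equals m (1 - m t) phi a + m^2 t phi b, which m-convexity yields at [m * b]
    and [a] with weight m t. What it subtracts is m times the bound of [m_convex_le_chord], so that
    the two results chain. *)
Lemma m_convex_mercer (R : realType) (a b m : R) (phi : R -> R) (x : R) :
  a <= 0 -> 0 <= b -> 0 <= m <= 1 -> m_convex `[a, b] m phi -> x \in `[a, b] ->
  phi (m * a + m ^+ 2 * b - m ^+ 2 * x) <=
    m * phi a + m ^+ 2 * phi b
    - m * (m * phi b + m * ((b - x) / (b - a)) * (phi a - phi b)).
Proof.
move=> a0 b0 /andP[m0 m1] hphi /barycentric_itvcc[].
set t := _ / _ => /andP[t0 t1] ->.
have Ia : `[a, b]%classic a by rewrite /= in_itv /= lexx (le_trans a0 b0).
have Ib : `[a, b]%classic b by rewrite /= in_itv /= lexx (le_trans a0 b0).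
have Imb : `[a, b]%classic (m * b) by rewrite /= in_itv /=; apply/andP; split; nra.
have h1 : phi (m * b) <= m * phi b.
  have := hphi b b 0 Ib Ib; rewrite lexx ler01 => /(_ isT).
  by rewrite !mul0r !add0r subr0 mulr1.
have mt01 : 0 <= m * t <= 1 by apply/andP; split; nra.
have := hphi (m * b) a (m * t) Imb Ia mt01.
rewrite (_ : m * t * (m * b) + m * (1 - m * t) * a =
  m * a + m ^+ 2 * b - m ^+ 2 * (t * a + (1 - t) * b)); last by ring.
move: mt01 => /andP[mt0 mt1] h2; have := ler_wpM2l mt0 h1; lra.
Qed.

(** * Averaging against a nonnegative weight *)

Section weighted.
Context d (T : measurableType d) (R : realType).
Context (mu : {measure set T -> \bar R}) (D : set T) (mD : measurable D).

Lemma m_convex_mercer_Rintegral (a b m : R) (phi : R -> R) (K f : T -> R)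
    (W := \int[mu]_(s in D) (1 / K s)) :
  a <= 0 -> 0 <= b -> 0 <= m <= 1 -> m_convex `[a, b] m phi ->
  (forall s, D s -> 0 <= K s) -> (forall s, D s -> f s \in `[a, b]) ->
  mu.-integrable D (fun s => (1 / K s)%:E) ->
  mu.-integrable D (fun s => (f s / K s)%:E) ->
  mu.-integrable D (fun s => (phi (m * f s) / K s)%:E) ->
  0 < W ->
  phi (m * a + m ^+ 2 * b - m ^+ 2 / W * \int[mu]_(s in D) (f s / K s)) <=
    m * phi a + m ^+ 2 * phi b
    - m / W * \int[mu]_(s in D) (phi (m * f s) / K s).
Proof.
move=> a0 b0 m01 hphi K0 fab iK ifK iphiK W0.
set F := \int[mu]_(s in D) (f s / K s); set P := \int[mu]_(s in D) (phi _ / _).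
have intZ (c : R) (h : T -> R) : mu.-integrable D (EFin \o h) ->
    mu.-integrable D (EFin \o (fun s => c * h s)).
  move=> ih; rewrite (_ : _ \o _ = fun s => (c%:E * (EFin \o h) s)%E) //.
  exact: integrableZl.
have iK' : mu.-integrable D (EFin \o (fun s => 1 / K s)) := iK.
have ifK' : mu.-integrable D (EFin \o (fun s => f s / K s)) := ifK.
(* Every comparison function below is an affine function of [f s] times the weight [1 / K s]. *)
have aff (u v : R) :
    mu.-integrable D (EFin \o (fun s => u * (1 / K s) + v * (f s / K s))) /\
    \int[mu]_(s in D) (u * (1 / K s) + v * (f s / K s)) = u * W + v * F.
  have iu := intZ u _ iK'; have iv := intZ v _ ifK'.
  split; last by rewrite RintegralD // RintegralZl // RintegralZl.
  rewrite (_ : _ \o _ = ((EFin \o (fun s => u * (1 / K s))%R) \+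
                         (EFin \o (fun s => v * (f s / K s))%R))%E) //.
  exact: integrableD.
have Kinv0 s : D s -> 0 <= (K s)^-1 by move=> /K0; rewrite invr_ge0.
(* The weighted mean of f lies in [a, b]: integrate a <= f s <= b against the weight. *)
have FW : F / W \in `[a, b].
  rewrite in_itv /= ler_pdivlMr // ler_pdivrMr //; apply/andP; split.
    have [iL eL] := aff a 0; rewrite -[a * W]addr0 -(mul0r F) -eL.
    apply: le_Rintegral => // s Ds; rewrite mul0r addr0 mulrA mulr1.
    by have := fab s Ds; rewrite in_itv /= => /andP[+ _]; apply/ler_wpM2r/Kinv0.
  have [iL eL] := aff b 0; rewrite -[b * W]addr0 -(mul0r F) -eL.
  apply: le_Rintegral => // s Ds; rewrite mul0r addr0 mulrA mulr1.
  by have := fab s Ds; rewrite in_itv /= => /andP[_]; apply/ler_wpM2r/Kinv0.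
clearbody F W.
have PF : P / W <= m * phi b + m * ((b - F / W) / (b - a)) * (phi a - phi b).
  rewrite ler_pdivrMr //.
  (* The chord bound at x is m phi b + (b - x) k, hence the coefficients passed to [aff]. The
     inverse of b - a is never cancelled, so a = b needs no separate case. *)
  set k := m * (phi a - phi b) / (b - a).
  have [iL eL] := aff (m * phi b + b * k) (- k).
  apply: (@le_trans _ _ ((m * phi b + b * k) * W + (- k) * F)); last first.
    rewrite le_eqVlt; apply/orP; left; apply/eqP.
    by rewrite -[F in LHS](divfK (lt0r_neq0 W0)) /k; ring.
  rewrite -eL; apply: le_Rintegral => // s Ds.
  rewrite (_ : _ + _ = (m * phi b + (b - f s) * k) / K s); last by rewrite /k; ring.
  apply: ler_wpM2r; first exact: Kinv0.
  have := m_convex_le_chord a0 b0 m01 hphi (fab s Ds).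
  by rewrite (_ : _ + _ = m * phi b + (b - f s) * k) // /k; ring.
have := m_convex_mercer a0 b0 m01 hphi FW.
rewrite (_ : m ^+ 2 / W * F = m ^+ 2 * (F / W)); last by ring.
rewrite (_ : m / W * P = m * (P / W)); last by ring.
case/andP: m01 => m0 _ /le_trans; apply.
by rewrite lerD2l lerN2; exact: ler_wpM2l.
Qed.
End weighted.

(** * Lebesgue measurability and negligible endpoints *)

Lemma measurable_borel_leb (R : realType) (A : set (measurableTypeR R)) :
  measurable A -> measurable (A : set (lebesgueR R)).
Proof. exact: sub_caratheodory. Qed.

Lemma measurable_fun_borel_leb d (T : measurableType d) (R : realType)
    (A : set (measurableTypeR R)) (h : R -> T) :
  measurable A -> measurable_fun A (h : measurableTypeR R -> T) ->
  measurable_fun (A : set (lebesgueR R)) (h : lebesgueR R -> T).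
Proof.
move=> mA mh _ Y mY; apply: measurable_borel_leb; exact: mh.
Qed.

(** Both measures evaluate the same outer measure, so the equality holds by conversion. *)
Lemma leb_lebesgue_measure (R : realType) (A : set R) :
  leb R A = lebesgue_measure A.
Proof. by []. Qed.

Lemma measurable_itv_leb (R : realType) (i : interval R) :
  measurable ([set` i] : set (lebesgueR R)).
Proof. exact: (@measurable_borel_leb R _ (measurable_itv i)). Qed.

Lemma leb_set2 (R : realType) (c d : R) : leb R [set c; d] = 0%E.
Proof.
rewrite leb_lebesgue_measure; apply: countable_lebesgue_measure0.
by apply: finite_set_countable; exact: finite_set2.
Qed.

Lemma integrable_leb_itvoo (R : realType) (c d : R) (h : R -> \bar R) :
  (leb R).-integrable `[c, d] h -> (leb R).-integrable `]c, d[ h.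
Proof.
apply: integrableS; [exact: measurable_itv_leb|exact: measurable_itv_leb|].
exact: subset_itv_oo_cc.
Qed.

Lemma measurable_set2_leb (R : realType) (c d : R) :
  measurable ([set c; d] : set (lebesgueR R)).
Proof. by apply: measurable_borel_leb; apply: measurableU. Qed.

(** Any function is measurable on a singleton, so arbitrary values at c and d, such as those of the
    kernel, do no harm. *)
Lemma measurable_fun_leb_itvcc (R : realType) (c d : R) d' (T : measurableType d')
    (h : lebesgueR R -> T) : c <= d ->
  measurable_fun (`]c, d[ : set (lebesgueR R)) h ->
  measurable_fun (`[c, d] : set (lebesgueR R)) h.
Proof.
move=> cd mh; rewrite -(setUitv_set2 false true cd).
apply/measurable_funU; [exact: measurable_itv_leb|exact: measurable_set2_leb|].
split=> //; apply/measurable_funU.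
- exact: (@measurable_borel_leb R _ (measurable_set1 c)).
- exact: (@measurable_borel_leb R _ (measurable_set1 d)).
- by split; exact: measurable_fun_set1.
Qed.

Lemma integral_leb_itvoo (R : realType) (c d : R) (h : lebesgueR R -> \bar R) :
  c <= d -> measurable_fun (`[c, d] : set (lebesgueR R)) h ->
  (\int[leb R]_(x in `[c, d]) h x = \int[leb R]_(x in `]c, d[) h x)%E.
Proof.
move=> cd; rewrite -(setUitv_set2 false true cd) => mh.
rewrite integral_setU //; [|exact: measurable_itv_leb|exact: measurable_set2_leb|].
  rewrite [X in (_ + X)%E]null_set_integral ?adde0 //.
  - exact: measurable_set2_leb.
  - apply: measurable_funS mh; last exact: subsetUr.
    by apply: measurableU; [exact: measurable_itv_leb|exact: measurable_set2_leb].
  - exact: leb_set2.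
apply/disj_setPS => x [/= + xcd]; rewrite in_itv /=.
by case: xcd => ->; rewrite ltxx ?andbF.
Qed.

(** * Continuity and positivity of the kernel *)

Lemma within_comp_continuous (S T U : topologicalType) (D : set T)
    (F : T -> U) (h : S -> T) (x : S) :
  {within D, continuous F} -> {for x, continuous h} ->
  (\forall y \near x, D (h y)) -> {for x, continuous (F \o h)}.
Proof.
move=> cF ch Dh.
have Dx : D (h x) by exact: (nbhs_singleton Dh).
have FD : F z @[z --> (h x : subspace D)] --> F (h x) := cF (h x).
(* F converges along the subspace topology of D, so h must converge in that topology too; it does
   because [h y] stays in D for y near x. *)
apply: (@cvg_comp _ _ _ h F _ (nbhs (h x : subspace D)) _ _ FD).
apply: (proj2 (@subspace_cvgP T D (h @ x) (h x) _ Dx)) => V /= hV.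
change (\forall y \near x, V (h y)).
near=> y; have Dy : D (h y) by near: y.
suff : D (h y) -> V (h y) by apply.
by near: y; exact: (ch _ hV).
Unshelve. all: end_near.
Qed.

Section kernel.
Context (R : realType) (c d alpha : R) (g : R -> R) (G : R -> R -> R).
Context (cd : c < d) (alpha0 : 0 < alpha).
Context (hg : kernel_base c d g) (hG : kernel_profile c d g G).

(** The derivative test is run on [x, y], inside ]c, d[, because g is not known to be continuous at
    c and d. *)
Lemma kernel_base_increasing : {in `]c, d[ &, {homo g : x y / x < y}}.
Proof.
case: hg => _ dg _ g'0 x y; rewrite !in_itv /= => /andP[cx _] /andP[_ yd] xy.
have sub z : z \in `[x, y] -> z \in `]c, d[.
  rewrite !in_itv /= => /andP[xz zy].
  by rewrite (lt_le_trans cx xz) (le_lt_trans zy yd).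
have suboo z : z \in `]x, y[ -> z \in `]c, d[.
  by move=> /subset_itv_oo_cc /sub.
apply: (@gtr0_derive1_incr _ g x y) => //; first by move=> z /suboo /dg.
  by move=> z /suboo /g'0.
by apply: derivable_within_continuous => z /sub /dg.
Qed.

Lemma kernel_gap_in s : s \in `]c, d[ -> g d - g s \in `]0, g d - g c].
Proof.
move=> sI; case: hG => gap _ _.
(* The gaps |g d - g t| and |g t - g c| are at most g d - g c, which gives the lower and the upper
   bound respectively. *)
have bounds t : t \in `]c, d[ -> g c <= g t <= g d.
  rewrite in_itv /= => /andP[ct td].
  have tI : t \in `[c, d] by rewrite in_itv /= !ltW.
  have cI : c \in `[c, d] by rewrite in_itv /= lexx ltW.
  have dI : d \in `[c, d] by rewrite in_itv /= lexx ltW.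
  have := gap _ _ dI tI; have := gap _ _ tI cI.
  rewrite !in_itv /= => /andP[_ h1] /andP[_ h2].
  have := ler_norm (g t - g c); have := ler_norm (g d - g t).
  by move=> h3 h4; apply/andP; split; rewrite -subr_ge0; lra.
have /andP[cs _] := bounds s sI.
rewrite in_itv /= lerB // andbT subr_gt0.
(* Strictness goes through the midpoint: g s < g ((s + d) / 2) <= g d. *)
have mI : (s + d) / 2 \in `]c, d[.
  by move: sI; rewrite !in_itv /= => /andP[cs' sd]; apply/andP; split; lra.
have /andP[_] := bounds _ mI; apply: lt_le_trans.
apply: kernel_base_increasing => //.
by move: sI; rewrite !in_itv /= => /andP[cs' sd]; lra.
Qed.

Lemma rl_kernel_gt0 s : s \in `]c, d[ -> 0 < rl_kernel g G d s alpha.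
Proof.
move=> sI; have gs := kernel_gap_in sI; case: hG => _ _ G0.
rewrite /rl_kernel divr_gt0 //; last by case: hg => _ _ _; exact.
have /andP[gs0 _] : 0 < g d - g s <= g d - g c by move: gs; rewrite in_itv.
by rewrite gtr0_norm //; exact: G0.
Qed.

Lemma rl_kernel_continuous s : s \in `]c, d[ ->
  {for s, continuous (fun s => rl_kernel g G d s alpha)}.
Proof.
move=> sI; case: hg => _ dg cg' g'0; case: hG => _ cG _.
apply: cvgM; last by apply: cvgV; [rewrite gt_eqF// g'0|exact: cg'].
(* G is continuous only relative to its domain; the gap stays in that domain for all points near
   s. *)
suff : {for s, continuous ((fun p : R * R => G p.1 p.2) \o
                           (fun s => (`|g d - g s|, alpha)))} by exact.
apply: within_comp_continuous cG _ _.
  apply: (@cvg_pair _ _ _ _ (nbhs `|g d - g s|) (nbhs alpha)); last exact: cvg_cst.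
  apply: cvg_norm; apply: cvgB; first exact: cvg_cst.
  exact/differentiable_continuous/derivable1_diffP/dg.
near=> y.
have yI : y \in `]c, d[ by near: y; exact: near_in_itvoo.
have := kernel_gap_in yI; rewrite /= !in_itv /= andbT => /andP[h1 h2].
by rewrite gtr0_norm // ltW // h2.
Unshelve. all: end_near.
Qed.

Lemma measurable_fun_rl_kernel :
  measurable_fun (`]c, d[ : set (lebesgueR R))
    (fun s : lebesgueR R => (1 / rl_kernel g G d s alpha : R)).
Proof.
apply: measurable_fun_borel_leb => //.
apply: open_continuous_measurable_fun; first exact: interval_open.
move=> s; rewrite inE => sI.
apply: cvgM; first exact: cvg_cst.
by apply: cvgV; [rewrite gt_eqF // rl_kernel_gt0|exact: rl_kernel_continuous].
Qed.

End kernel.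

(** * Integrability and the final inequality *)

Lemma Rintegral_leb_itvoo (R : realType) (c d : R) (h : R -> R) : c <= d ->
  (leb R).-integrable `[c, d] (fun s => (h s)%:E) ->
  \int[leb R]_(x in `[c, d]) h x = \int[leb R]_(x in `]c, d[) h x.
Proof.
by move=> cd ih; rewrite /Rintegral integral_leb_itvoo //; case/integrableP: ih.
Qed.

(** A zero integral would force h = 0 almost everywhere on D, so D would be contained in a null
    set. *)
Lemma integral_gt0 d (T : measurableType d) (R : realType)
    (mu : {measure set T -> \bar R}) (D : set T) (h : T -> \bar R) :
  measurable D -> measurable_fun D h -> (forall x, D x -> (0 < h x)%E) ->
  (0 < mu D)%E -> (0 < \int[mu]_(x in D) h x)%E.
Proof.
move=> mD mh h0 D0.
rewrite lt0e integral_ge0 ?andbT; last by move=> x /h0/ltW.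
apply/eqP => h_eq0.
have habs : (\int[mu]_(x in D) `|h x| = 0)%E.
  by rewrite -h_eq0; apply: eq_integral => x; rewrite inE => /h0/ltW/gee0_abs.
have [N [mN N0 sub]] := (ae_eq_integral_abs mu mD mh).1 habs.
have : (mu D <= mu N)%E.
  apply: le_measure; rewrite ?inE // => x Dx; apply: sub => /= /(_ Dx) hx.
  by have := h0 x Dx; rewrite hx ltxx.
by rewrite N0 leNgt D0.
Qed.

Lemma continuous_itvcc_bounded (R : realType) (a b : R) (h : R -> R) :
  {within `[a, b], continuous h} -> [bounded h x | x in `[a, b]].
Proof.
move=> ch; have := compact_bounded (continuous_compact ch (@segment_compact _ a b)).
move=> [M [Mr hM]]; exists M; split=> // x /hM {}hM y aby.
by apply: hM; exists y.
Qed.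

Theorem proposition19 (R : realType) (c d a b alpha m : R)
    (g : R -> R) (G : R -> R -> R) (f phi : R -> R) (TT : R)
    (hcd : c < d) (ha : a <= 0) (hb : 0 <= b) (halpha : 0 < alpha)
    (hm0 : 0 < m) (hm1 : m <= 1)
    (hg : kernel_base c d g)
    (hG : kernel_profile c d g G)
    (hf : measurable_fun (`[c, d] : set (lebesgueR R))
            (f : lebesgueR R -> R))
    (hfab : forall s, s \in `[c, d] -> f s \in `[a, b])
    (hphi : {within `[a, b], continuous phi})
    (hconv : m_convex `[a, b] m phi)
    (hT1 : (\int[leb R]_(s in `[c, d]) (1 / rl_kernel g G d s alpha)%:E)%E
             = TT%:E)
    (hT2 : (\int[leb R]_(x in `[0%R, (g d - g c)%R]) (1 / G x alpha)%:E)%E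
             = TT%:E) :
  [/\ (leb R).-integrable `[c, d]
        (fun s => (f s / rl_kernel g G d s alpha)%:E),
      (leb R).-integrable `[c, d]
        (fun s => (phi (m * f s) / rl_kernel g G d s alpha)%:E) &
      phi (m * a + m ^+ 2 * b
           - m ^+ 2 / TT
             * \int[leb R]_(s in `[c, d]) (f s / rl_kernel g G d s alpha))
      <= m * phi a + m ^+ 2 * phi b
         - m / TT
           * \int[leb R]_(s in `[c, d]) (phi (m * f s) / rl_kernel g G d s alpha)].
Proof.
have m01 : 0 <= m <= 1 by rewrite ltW.
have mcc := measurable_itv_leb `[c, d].
have moo := measurable_itv_leb `]c, d[.
have Kgt0 s : `]c, d[%classic s -> 0 < rl_kernel g G d s alpha.
  by move=> sI; exact: (rl_kernel_gt0 hcd halpha hg hG sI).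
set K := fun s => rl_kernel g G d s alpha in Kgt0 *.
have mKoo : measurable_fun (`]c, d[ : set (lebesgueR R))
    (fun s : lebesgueR R => 1 / K s : R).
  exact: (measurable_fun_rl_kernel hcd halpha hg hG).
have mK := measurable_fun_leb_itvcc (ltW hcd) mKoo.
have emKoo : measurable_fun (`]c, d[ : set (lebesgueR R))
    (fun s : lebesgueR R => (1 / K s)%:E) by exact/measurable_EFinP.
have emK : measurable_fun (`[c, d] : set (lebesgueR R))
    (fun s : lebesgueR R => (1 / K s)%:E) by exact/measurable_EFinP.
(* The weight may be negative at c and d, where derive1 g is a junk value, so
   hT1 gives integrability only after discarding these two points. *)
have iK : (leb R).-integrable `[c, d] (fun s => (1 / K s)%:E).
  apply/(negligible_integrable (measurable_set2_leb c d) mcc emK (leb_set2 c d)).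
  rewrite setDitv_set2; apply/integrableP; split=> //.
  rewrite (_ : integral _ _ _ = TT%:E) ?ltry //.
  rewrite -hT1 integral_leb_itvoo ?(ltW hcd) //; apply: eq_integral => s.
  by rewrite inE => /Kgt0 K0; rewrite gee0_abs // lee_fin divr_ge0 // ltW.
(* A bounded measurable function times the integrable weight is integrable; this serves both f and
   phi (m f). *)
have intM (h : R -> R) :
    measurable_fun (`[c, d] : set (lebesgueR R)) (h : lebesgueR R -> R) ->
    [bounded h x | x in `[c, d]] ->
    (leb R).-integrable `[c, d] (fun s => (h s / K s)%:E).
  move=> mh bh; rewrite (_ : (fun s => _) =
    ((EFin \o h) \* (fun s => (1 / K s)%:E))%E); first exact: integrableMr.
  by apply/funext => s /=; rewrite -EFinM mul1r.
have ifK : (leb R).-integrable `[c, d] (fun s => (f s / K s)%:E).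
  apply: intM => //; exists (`|a| + `|b|); split; first exact: num_real.
  move=> M hM s /hfab; rewrite in_itv /= => /andP[af fb].
  apply: le_trans (ltW hM); rewrite (ler0_norm ha) (ger0_norm hb) ler_norml.
  by apply/andP; split; lra.
(* Scaling by m in ]0, 1] moves points towards 0, which lies in [a, b]. *)
have mfab s : s \in `[c, d] -> m * f s \in `[a, b].
  move=> /hfab; rewrite !in_itv /= => /andP[af fb].
  by apply/andP; split; nra.
have iphiK : (leb R).-integrable `[c, d] (fun s => (phi (m * f s) / K s)%:E).
  apply: (intM (fun s => phi (m * f s))).
    (* The intermediate space carries the Borel sigma-algebra: phi is Borel on [a, b], and f pulls
       Borel sets back to Lebesgue sets. *)
    apply: (@measurable_comp _ _ _ _ _ _ (`[a, b] : set (measurableTypeR R)) phi _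
      (fun s : lebesgueR R => m * f s)) => //.
    - by move=> _ [s /mfab ? <-].
    - exact: subspace_continuous_measurable_fun.
    - by apply: measurable_funM => //; exact: measurable_cst.
  have [M [Mr hM]] := continuous_itvcc_bounded hphi.
  exists M; split=> // x /hM {}hM s /mfab; exact: hM.
split=> //.
(* All integrals move to ]c, d[, where the kernel is positive. *)
have TTE : TT = \int[leb R]_(s in `]c, d[) (1 / K s).
  by rewrite -Rintegral_leb_itvoo ?(ltW hcd) // /Rintegral hT1.
rewrite (Rintegral_leb_itvoo (ltW hcd) ifK).
rewrite (Rintegral_leb_itvoo (ltW hcd) iphiK) TTE.
apply: m_convex_mercer_Rintegral => //.
- by move=> s /Kgt0/ltW.
- by move=> s /subset_itv_oo_cc/hfab.
- exact: integrable_leb_itvoo.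
- exact: integrable_leb_itvoo.
- exact: integrable_leb_itvoo.
(* TT > 0, as the integral of a positive function over a set of measure d - c > 0. *)
- rewrite -TTE -lte_fin -hT1 integral_leb_itvoo ?(ltW hcd) //.
  apply: integral_gt0 => //.
  + by move=> s /Kgt0 K0; rewrite lte_fin divr_gt0.
  + rewrite leb_lebesgue_measure lebesgue_measure_itv /= lte_fin hcd.
    by rewrite -EFinB lte_fin subr_gt0.
Qed.
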